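(* Let $p\ge 17$ be prime and let $A,B\in\mathbb{N}$. Put $\bar A=A\bmod p$, $\bar B=B\bmod p$, and \[ r=\left(\left\lfloor\frac{\left(2^{3p^2}+\bar A\,2^{p^2}+\bar B\right)^{\lfloor p/2\rfloor}}{2^{p^2(p-1)}}\right\rfloor\bmod 2^{p^2}\right)\bmod p . \] Then the number $N$ of points $(x,y)\in(\mathbb{Z}/p\mathbb{Z})^2$ with $y^2=x^3+Ax+B$ equals \[ N=(p\mathbin{\dot{-}}r)+p\cdot\Bigl(1\mathbin{\dot{-}}\bigl((4p+1)\mathbin{\dot{-}}r^2\bigr)\Bigr). \] Equivalently, the quantity $a_p:=p-N$ equals $r$ if $r^2\le 4p$, and equals $r-p$ otherwise; in the nonsingular case ($4\bar A^3+27\bar B^2\not\equiv 0\pmod p$) this is the trace of Frobenius of the elliptic curve $y^2=x^3+\bar Ax+\bar B$ over $\mathbb{F}_p$. The statement holds for every pair $(A,B)$, including the pairs for which the cubic $x^3+\bar Ax+\bar B$ has a repeated root modulo $p$. The number of projective points of the cubic (points over $\mathbb{F}_p$ of the projective closure of $y^2=x^3+\bar Ax+\bar B$) is $N+1$.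
   Context: $\mathbb{N}$ includes $0$. Truncated subtraction is $x\mathbin{\dot{-}}y=\max(x-y,0)$. $a\bmod b$ denotes the least nonnegative residue. *)

(* Defs.v *)
From HB Require Import structures.
From mathcomp Require Import all_boot all_order all_algebra.

Set Implicit Arguments.
Unset Strict Implicit.
Unset Printing Implicit Defensive.

Import Order.TTheory GRing.Theory Num.Theory.
Local Open Scope ring_scope.

Definition affine_points (F : finFieldType) (a b : F) : {set F * F} :=
  [set P : F * F | P.2 ^+ 2 == P.1 ^+ 3 + a * P.1 + b].

(* The projective point [v 0 0 : v 0 1 : v 0 2], as the set of its nonzero
   coordinate vectors; meaningful only for v != 0. *)
Definition proj_point (F : finFieldType) (v : 'rV[F]_3) : {set 'rV[F]_3} :=
  [set c *: v | c in [set c : F | c != 0]].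

(* Y^2 Z = X^3 + a X Z^2 + b Z^3, the homogenization of the affine equation:
   its zero locus is the projective closure of the affine cubic. *)
Definition homogeneous_eqn (F : finFieldType) (a b : F) (v : 'rV[F]_3) : bool :=
  let X := v 0 0 in let Y := v 0 1 in let Z := v 0 2 in
  Y ^+ 2 * Z == X ^+ 3 + a * X * Z ^+ 2 + b * Z ^+ 3.

Definition projective_points (F : finFieldType) (a b : F) :
    {set {set 'rV[F]_3}} :=
  [set proj_point v | v in [set v | (v != 0) && homogeneous_eqn a b v]].

(* Elliptic curves in short Weierstrass form; the discriminant condition
   is equivalent to smoothness in every characteristic. *)
Record elliptic_curve (F : finFieldType) := EllipticCurve {
  ec_a : F;
  ec_b : F;
  ec_disc_neq0 : - 16 * (4 * ec_a ^+ 3 + 27 * ec_b ^+ 2) != 0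
}.

(* The usual definition t = q + 1 - #E(F_q) of the trace of Frobenius. *)
Definition frobenius_trace (F : finFieldType) (E : elliptic_curve F) : int :=
  #|F|%:Z + 1 - #|projective_points (ec_a E) (ec_b E)|%:Z.

(* Main.v *)
Require Import Defs.
From HB Require Import structures.
From mathcomp Require Import all_boot all_order all_algebra all_field.
From mathcomp Require Import ring zify.

(** Hasse's bound [(q - N)^2 <= 4 q] is proved by a Vieta-jumping form of
    Manin's argument. Let [E] be the quadratic twist
    [lam(t) y^2 = x^3 + a x + b] over [F(t)], where [lam = t^3 + a t + b], with
    its points [Q = (t, 1)] and [P_0 = (t^q, lam^((q-1)/2))], and let
    [f_n / g_n] be the reduced abscissa of [P_0 + n Q]. For [P] of abscissa
    [f / g], the abscissas of [P + Q] and [P - Q] are the two roots of a quadratic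
    equation whose coefficients [quad2, quad1, quad0] are polynomial in [f, g, t]
    and, when the discriminant is nonzero, have no common factor. The relation
    stating that [x'] is a root of the quadratic of [x] is symmetric in [x] and
    [x'], so the whole sequence arises from two
    consecutive terms by passing to the other root, and neither ordinates nor
    the group law are needed. The product of the roots gives
    [deg f_(n+1) + deg f_(n-1) = 2 deg f_n + 2]; as [deg f_0 = q] and
    [deg f_(-1) = N + 1], we get [deg f_n = n^2 + (q - N) n + q >= 0] for every
    integer [n], which forces the bound. If the discriminant vanishes, the cubic
    is [(x - c)^2 (x + 2 c)] and [|q - N| <= 1].

    By Kronecker substitution [r] is the coefficient of [X^(p-1)] in
    [(X^3 + A X + B)^((p-1)/2)] modulo [p]; by Euler's criterion and the power
    sums over ['F_p] it is congruent to [p - N]. For [p >= 17] Hasse's bound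
    gives [2 |p - N| < p], so [r] determines [N]. *)

Set Implicit Arguments.
Unset Strict Implicit.
Unset Printing Implicit Defensive.

Import Order.TTheory GRing.Theory Num.Theory.
Local Open Scope ring_scope.

(** * Vieta jumping *)

Section VietaJumping.

Variables (F : fieldType) (a b : F).
Hypotheses (two_neq0 : (2 : F) != 0)
  (disc_neq0 : 4 * a ^+ 3 + 27 * b ^+ 2 != 0).

Implicit Types f g : {poly F}.

Definition cubic : {poly F} := 'X^3 + a%:P * 'X + b%:P.

(* The abscissas [x'] of [P + Q] and [P - Q], where [P] has abscissa [f / g] and
   [Q] has abscissa ['X], are the roots of [quad2 x'^2 - quad1 x' + quad0]. *)
Definition quad2 f g : {poly F} := (f - 'X * g) ^+ 2.
Definition quad1 f g : {poly F} :=
  2%:P * ((f + 'X * g) * (a%:P * g + 'X * f) + 2%:P * b%:P * g ^+ 2).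
Definition quad0 f g : {poly F} :=
  ('X * f - a%:P * g) ^+ 2 - 4%:P * b%:P * g * (f + 'X * g).

Definition quad_rel f g f' g' : {poly F} :=
  quad2 f g * f' ^+ 2 - quad1 f g * f' * g' + quad0 f g * g' ^+ 2.

Lemma quad_relC f g f' g' : quad_rel f g f' g' = quad_rel f' g' f g.
Proof. rewrite /quad_rel /quad2 /quad1 /quad0; ring. Qed.

(** The quartic over [4 * cubic] is the duplication formula for abscissas. An explicit Bezout
    identity between the two yields a nonzero constant. *)
Lemma cubic_duplication_bezout (h : {poly F}) :
  h %| cubic -> h %| ('X^2 - a%:P) ^+ 2 - 8%:P * b%:P * 'X -> h %| 1.
Proof.
move=> hc hd.
suff: h %| (4 * a ^+ 3 + 27 * b ^+ 2)%:P.
  by rewrite -[X in _ %| X]mulr1 mul_polyC dvdpZr.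
have -> : (4 * a ^+ 3 + 27 * b ^+ 2)%:P =
  (3%:P * 'X^2 + 4%:P * a%:P) * (('X^2 - a%:P) ^+ 2 - 8%:P * b%:P * 'X)
  - (3%:P * 'X^3 - 5%:P * a%:P * 'X - 27%:P * b%:P) * cubic.
  rewrite /cubic; ring.
by rewrite dvdp_sub // dvdp_mull.
Qed.

(** Modulo [e = f - 'X * g], [quad1] becomes [4 g^2 cubic] and [quad0] becomes [g^2] times the
    duplication quartic, so [h] is coprime to [e]; yet [h] divides [quad2 = e ^+ 2]. *)
Lemma quad_primitive f g (h : {poly F}) : coprimep f g ->
  h %| quad2 f g -> h %| quad1 f g -> h %| quad0 f g -> h %| 1.
Proof.
move=> cfg h2 h1 h0.
pose e := f - 'X * g.
pose k := gcdp h e.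
have ke : k %| e by apply: dvdp_gcdr.
have kh : k %| h by apply: dvdp_gcdl.
have ckg : coprimep k g.
  apply/coprimepP => d dk dg; rewrite -size_poly_eq1 -dvdp1.
  have df : d %| f.
    have -> : f = e + 'X * g by rewrite /e; ring.
    by rewrite dvdp_add ?dvdp_mull // (dvdp_trans dk).
  by move: cfg; rewrite -gcdp_eqp1 => /eqp_dvdr <-; rewrite dvdp_gcd df.
have ckg2 : coprimep k (g ^+ 2) by rewrite coprimep_expr.
have kc : k %| cubic.
  rewrite -(Gauss_dvdpr _ ckg2).
  have : k %| (2^+2)%:P * (g ^+ 2 * cubic).
    have -> : (2^+2)%:P * (g ^+ 2 * cubic) = quad1 f g
      - e * (2%:P * (a%:P * g + 'X * f) + 4%:P * 'X ^+ 2 * g).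
      rewrite /cubic /quad1 /e; ring.
    by apply: dvdp_sub; [apply: dvdp_trans kh _ | apply: dvdp_mulr].
  by rewrite mul_polyC dvdpZr // expf_neq0.
have kd : k %| ('X^2 - a%:P) ^+ 2 - 8%:P * b%:P * 'X.
  rewrite -(Gauss_dvdpr _ ckg2).
  have -> : g ^+ 2 * (('X^2 - a%:P) ^+ 2 - 8%:P * b%:P * 'X) = quad0 f g
      - e * ('X * ('X * f - a%:P * g + 'X ^+ 2 * g - a%:P * g)
             - 4%:P * b%:P * g).
    rewrite /quad0 /e; ring.
  by apply: dvdp_sub; [apply: dvdp_trans kh _ | apply: dvdp_mulr].
have : coprimep h e.
  by rewrite -gcdp_eqp1 -size_poly_eq1 -dvdp1 (cubic_duplication_bezout kc kd).
move/(coprimep_expr 2) => che.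
have : coprimep h h by apply: coprimep_dvdl che.
by rewrite coprimepp dvdp1.
Qed.

(* [f / g] and [f' / g'] in lowest terms are the abscissas of two consecutive
   points; [size g < size f] says that the abscissa has a pole at infinity. *)
Record adjacent f g f' g' : Prop := Adjacent {
  adj_coprimel : coprimep f g;
  adj_coprimer : coprimep f' g';
  adj_sizel : (size g < size f)%N;
  adj_sizer : (size g' < size f')%N;
  adj_rel : quad_rel f g f' g' = 0 }.

Lemma adjacentC f g f' g' : adjacent f g f' g' -> adjacent f' g' f g.
Proof. by case=> c1 c2 s1 s2 r; split; rewrite // quad_relC. Qed.

(** By Gauss's lemma [g'] and [f'] divide the outer coefficients; the cofactors form the other root
    [f'' / g'']. *)
Lemma quad_vieta f g f' g' : coprimep f g -> f' != 0 ->
  coprimep f' g' -> quad_rel f g f' g' = 0 ->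
  exists f'' g'', [/\ quad2 f g = g' * g'',
    quad1 f g = f' * g'' + g' * f'' & quad0 f g = f' * f''].
Proof.
move=> cfg f'0 cf'g'; rewrite /quad_rel => rel.
(* If [g' = 0] the known root is infinite: [f'] is a nonzero constant and [quad2] vanishes. *)
have [g'0|g'0] := eqVneq g' 0.
  move: cf'g'; rewrite g'0 coprimep0 => f'1.
  have df' p : p = f' * (p %/ f').
    by rewrite mulrC divpK // (eqp_dvdl _ f'1) dvd1p.
  move: rel; rewrite g'0 mulr0 subr0 expr0n mulr0 addr0 => /eqP.
  rewrite mulf_eq0 (negbTE (expf_neq0 2 f'0)) orbF => /eqP q20.
  exists (quad0 f g %/ f'), (quad1 f g %/ f').
  by rewrite q20 !mul0r addr0 -!df'.
have d2 : g' %| quad2 f g.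
  have c : coprimep g' (f' ^+ 2) by rewrite coprimep_expr // coprimep_sym.
  rewrite -(Gauss_dvdpl _ c).
  have -> : quad2 f g * f' ^+ 2 = g' * (quad1 f g * f' - quad0 f g * g').
    by apply/eqP; rewrite -subr_eq0 -rel; apply/eqP; ring.
  exact: dvdp_mulIl.
have d0 : f' %| quad0 f g.
  have c : coprimep f' (g' ^+ 2) by rewrite coprimep_expr.
  rewrite -(Gauss_dvdpl _ c).
  have -> : quad0 f g * g' ^+ 2 = f' * (quad1 f g * g' - quad2 f g * f').
    by apply/eqP; rewrite -subr_eq0 -rel; apply/eqP; ring.
  exact: dvdp_mulIl.
exists (quad0 f g %/ f'), (quad2 f g %/ g').
have e2 : quad2 f g = g' * (quad2 f g %/ g') by rewrite mulrC divpK.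
have e0 : quad0 f g = f' * (quad0 f g %/ f') by rewrite mulrC divpK.
split=> //; apply/eqP.
have : f' * g' * (f' * (quad2 f g %/ g') + g' * (quad0 f g %/ f') - quad1 f g)
  = 0.
  by rewrite -rel {2}e2 {2}e0; ring.
by move/eqP; rewrite !mulf_eq0 (negbTE f'0) (negbTE g'0) subr_eq0 eq_sym.
Qed.

Lemma size_sum_X f g : (size g < size f)%N ->
  (size (f + 'X * g)%R <= size f)%N.
Proof.
move=> gf; apply: leq_trans (size_polyD _ _) _.
rewrite geq_max leqnn /=.
have [->|g0] := eqVneq g 0; first by rewrite mulr0 size_poly0.
by rewrite mulrC size_mulX.
Qed.

Lemma size_quad0 f g : (size g < size f)%N ->
  size (quad0 f g) = (size f).*2.+1.
Proof.
move=> gf; have f0 : f != 0 by rewrite -size_poly_gt0 (leq_ltn_trans _ gf).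
have sf : (0 < size f)%N by rewrite size_poly_gt0.
have sX : size ('X * f) = (size f).+1 by rewrite mulrC size_mulX.
have s1 : size ('X * f - a%:P * g) = (size f).+1.
  rewrite size_polyDl sX // size_polyN mul_polyC ltnS.
  exact: leq_trans (size_scale_leq _ _) (ltnW gf).
have s2 : size (('X * f - a%:P * g) ^+ 2) = (size f).*2.+1.
  rewrite expr2 size_mul -?size_poly_gt0 s1 // -mul2n; lia.
rewrite /quad0 size_polyDl s2 // size_polyN -polyCM -mulrA mul_polyC ltnS.
apply: leq_trans (size_scale_leq _ _) _.
apply: leq_trans (size_polyMleq _ _) _.
move: (gf) (size_sum_X gf); move: (size _) (size _) (size _) => u v w; lia.
Qed.

(** The bound is one less than the size of [quad0]; this gap carries the pole at infinity over to
    the next term. *)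
Lemma size_quad1 f g : (size g < size f)%N ->
  (size (quad1 f g) <= (size f).*2)%N.
Proof.
move=> gf; have f0 : f != 0 by rewrite -size_poly_gt0 (leq_ltn_trans _ gf).
have sX : size ('X * f) = (size f).+1 by rewrite mulrC size_mulX.
rewrite /quad1 mul_polyC; apply: leq_trans (size_scale_leq _ _) _.
apply: leq_trans (size_polyD _ _) _; rewrite geq_max; apply/andP; split.
  apply: leq_trans (size_polyMleq _ _) _.
  have s1 : (size (a%:P * g + 'X * f)%R <= (size f).+1)%N.
    apply: leq_trans (size_polyD _ _) _.
    rewrite geq_max sX leqnn andbT mul_polyC.
    by apply: leq_trans (size_scale_leq _ _) _; apply: leq_trans (ltnW gf) _.
  have := size_sum_X gf.
  rewrite -mul2n; lia.
rewrite -polyCM mul_polyC; apply: leq_trans (size_scale_leq _ _) _.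
rewrite expr2; apply: leq_trans (size_polyMleq _ _) _.
by rewrite -mul2n; lia.
Qed.

Lemma adjacent_next f g f' g' : adjacent f g f' g' ->
  exists f'' g'', adjacent f' g' f'' g'' /\
    (size f'' + size f = (size f').*2 + 2)%N.
Proof.
move/adjacentC=> [cl cr sl sr rel].
have f0 : f != 0 by rewrite -size_poly_gt0 (leq_ltn_trans _ sr).
have [f'' [g'' [e2 e1 e0]]] := quad_vieta cl f0 cr rel.
have s0 := size_quad0 sl; have s1 := size_quad1 sl.
have f''0 : f'' != 0.
  by apply/eqP => z; move: s0; rewrite e0 z mulr0 size_poly0.
have ss : (size f'' + size f = (size f').*2 + 2)%N.
  have := s0; rewrite e0 size_mul //.
  have : (0 < size f)%N by rewrite size_poly_gt0.
  by move: (size f) (size f') (size f'') => u v w; lia.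
exists f'', g''; split=> //; split=> //.
(* A common divisor of [f''] and [g''] divides all three coefficients. *)
- apply/coprimepP => d df dg; rewrite -size_poly_eq1 -dvdp1.
  apply: (quad_primitive cl); rewrite ?e2 ?e1 ?e0 ?dvdp_mull //.
  by rewrite dvdp_add ?dvdp_mull.
(* Without a pole, [f * g''] would dominate [quad1] and give it size at least [(size f').*2.+1],
   above its bound. *)
- rewrite ltnNge; apply/negP => sg.
  have g''0 : g'' != 0.
    by rewrite -size_poly_gt0 (leq_trans _ sg) // size_poly_gt0.
  have lt : (size (g * f'')%R < size (f * g'')%R)%N.
    have [->|g0] := eqVneq g 0.
      by rewrite mul0r size_poly0 size_poly_gt0 mulf_neq0.
    have : (0 < size g)%N by rewrite size_poly_gt0.
    rewrite !size_mul //; move: sr sg.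
    by move: (size f) (size g) (size f'') (size g'') => u v w z; lia.
  have := s1; rewrite e1 size_polyDl // size_mul //; move: sg ss.
  by move: (size f) (size f') (size f'') (size g'') => u v w z; lia.
- by rewrite /quad_rel e2 e1 e0; ring.
Qed.

(** The expression is the size, that is the degree plus one, of the [n]-th numerator of the sequence
    starting with [f], [f']; its second difference is 2. *)
Lemma adjacent_degree_gt0 f g f' g' : adjacent f g f' g' -> forall n : nat,
  0 < n%:Z ^+ 2 + ((size f')%:Z - (size f)%:Z - 1) * n%:Z + (size f)%:Z.
Proof.
move=> adj n; elim: n f g f' g' adj => [|n IHn] f g f' g' adj.
  by rewrite mulr0 expr0n add0r ltz_nat (leq_ltn_trans _ (adj_sizel adj)).
have [f'' [g'' [adj' e]]] := adjacent_next adj.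
have := IHn _ _ _ _ adj'.
have -> : (size f'')%:Z = 2 * (size f')%:Z + 2 - (size f)%:Z.
  by move: e; move: (size f) (size f') (size f'') => u v w; lia.
have -> : n.+1%:Z = n%:Z + 1 by lia.
by congr (0 < _); ring.
Qed.

End VietaJumping.

Lemma size_cubic (F : fieldType) (a b : F) : size (cubic a b) = 4%N.
Proof.
rewrite /cubic -addrA size_polyDl size_polyXn //.
apply: leq_ltn_trans (size_polyD _ _) _.
rewrite gtn_max mul_polyC; apply/andP; split.
  by apply: leq_ltn_trans (size_scale_leq _ _) _; rewrite size_polyX.
exact: leq_ltn_trans (size_polyC_leq1 _) _.
Qed.

Lemma size_cubic_exp (F : fieldType) (a b : F) n :
  size (cubic a b ^+ n) = (3 * n).+1.
Proof.
have c0 : cubic a b != 0 by rewrite -size_poly_gt0 size_cubic.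
rewrite -[LHS]prednK ?size_poly_gt0 ?expf_neq0 //.
by rewrite size_exp size_cubic.
Qed.

(** * Quadratic residues and power sums *)

Section QuadraticResidues.

Variable F : finFieldType.

Lemma finField_pnat_card : [pchar F].-nat #|F|.
Proof.
have [p p_pr pF] := finPcharP F.
by rewrite (card_pprimeChar pF) (eq_pnat _ (pcharf_eq pF)) pnatX pnat_id.
Qed.

Lemma finField_natr_card : #|F|%:R = 0 :> F.
Proof.
have [p p_pr pF] := finPcharP F.
have n0 : logn p #|F| != 0%N.
  apply/eqP => n0; have := finNzRing_gt1 F.
  by rewrite (card_pprimeChar pF) n0.
by rewrite (card_pprimeChar pF) natrX (pcharf0 pF) expr0n (negbTE n0).
Qed.

Lemma polyXD_card (u v : {poly F}) :
  (u + v) ^+ #|F| = u ^+ #|F| + v ^+ #|F|.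
Proof.
apply: exprDn_pchar.
by rewrite (eq_pnat _ (pchar_poly F)) finField_pnat_card.
Qed.

Lemma sum_expf (k : nat) : (k < #|F|.-1.*2)%N ->
  \sum_(x : F) x ^+ k = if k == #|F|.-1 then -1 else 0.
Proof.
have F1 := finNzRing_gt1 F.
case: k => [|k] kF.
  rewrite (eq_bigr (fun=> 1)) // sumr_const finField_natr_card.
  by case: #|F| F1 => [|[|n]].
(* Since [x ^+ q = x], an exponent above [q - 1] can be lowered by [q - 1] and stays positive. *)
wlog kle : k kF / (k < #|F|.-1)%N.
  move=> H; have [//|kge] := ltnP k #|F|.-1; first exact: H.
  have e : k.+1 = ((k - #|F|.-1).+1 + #|F|.-1)%N by lia.
  have -> : (k.+1 == #|F|.-1) = ((k - #|F|.-1).+1 == #|F|.-1) && false.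
    by rewrite andbF; apply/negbTE; lia.
  rewrite andbF.
  transitivity (\sum_(x : F) x ^+ (k - #|F|.-1).+1).
    apply: eq_bigr => x _; rewrite e.
    have -> : ((k - #|F|.-1).+1 + #|F|.-1 = (k - #|F|.-1) + #|F|)%N by lia.
    by rewrite exprD expf_card -exprSr.
  rewrite H; [|lia|lia].
  by case: eqP => // z; exfalso; lia.
have [ek|nek] := eqVneq k.+1 #|F|.-1.
  rewrite (bigD1 0) //= expr0n add0r (eq_bigr (fun=> 1)); last first.
    move=> x x0; apply: (mulfI x0); rewrite mulr1 -exprS ek.
    by rewrite prednK ?expf_card // ltnW.
  rewrite sumr_const cardC1 -[RHS]add0r -finField_natr_card.
  by rewrite -{2}(prednK (ltnW F1)) -natr1 addrK.
(* ['X^(k.+1) - 1] has too few roots to vanish at all nonzero elements. Substituting [g * x] for [x]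
   multiplies the sum by [g ^+ k.+1], so the sum is zero. *)
have [g g0 gk] : exists2 g : F, g != 0 & g ^+ k.+1 != 1.
  have [/exists_inP//|] := boolP [exists (x : F | x != 0), x ^+ k.+1 != 1].
  rewrite negb_exists_in => /forall_inP H; exfalso.
  have p0 : 'X^(k.+1) - 1 != 0 :> {poly F}.
    by rewrite -size_poly_gt0 size_XnsubC.
  have := @max_poly_roots F _ (enum [pred x : F | x != 0]) p0.
  rewrite enum_uniq size_XnsubC // -cardE cardC1.
  suff -> : all (root ('X^(k.+1) - 1)) (enum [pred x : F | x != 0]).
    by move=> /(_ isT isT) le; move: nek; rewrite eqn_leq kle -ltnS le.
  apply/allP => x; rewrite mem_enum inE => x0.
  rewrite rootE !hornerE subr_eq0.
  by have := H x x0; rewrite negbK.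
apply/eqP; have : (g ^+ k.+1 - 1) * \sum_(x : F) x ^+ k.+1 = 0.
  rewrite mulrBl mul1r mulr_sumr.
  apply/eqP; rewrite subr_eq0; apply/eqP.
  rewrite [RHS](reindex_inj (mulfI g0)).
  by apply: eq_bigr => x _; rewrite exprMn.
by move/eqP; rewrite mulf_eq0 subr_eq0 (negbTE gk).
Qed.

Hypothesis F_odd : odd #|F|.

Local Notation m := (#|F|./2).

Lemma odd_card_double : #|F| = m.*2.+1.
Proof. by rewrite -[LHS]odd_double_half F_odd. Qed.

Lemma half_card_gt0 : (0 < m)%N.
Proof. by move: (finNzRing_gt1 F); rewrite odd_card_double; case: m. Qed.

Lemma two_neq0_finField : (2 : F) != 0.
Proof.
apply/eqP => z; have := finField_natr_card.
rewrite odd_card_double -natr1 -mul2n natrM z mul0r add0r.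
by apply/eqP; rewrite oner_eq0.
Qed.

Lemma expf_double_half (x : F) : x != 0 -> x ^+ m.*2 = 1.
Proof.
move=> x0; apply: (mulfI x0).
by rewrite mulr1 -exprS -odd_card_double expf_card.
Qed.

Lemma expf_half_neq1 (x : F) : x != 0 -> (x ^+ m != 1) = (x ^+ m == -1).
Proof.
move=> x0; have := expf_double_half x0.
rewrite -muln2 exprM => /eqP; rewrite sqrf_eq1.
case: eqP => [->|_] /= // _.
apply/esym/negbTE; rewrite -subr_eq0 opprK; exact: two_neq0_finField.
Qed.

Definition nb_sqrt (c : F) : nat := #|[set y : F | y ^+ 2 == c]|.

(* Were [c] not a square, the cofactor [Q] of ['X^2 - c] in ['X^(q-1) - 1] would
   vanish on all [q - 1] nonzero elements, more than its degree [q - 3]. *)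
Lemma euler_criterion (c : F) : c ^+ m = 1 -> exists y, y ^+ 2 = c.
Proof.
move=> cm; have [/existsP[y /eqP]|] := boolP [exists y, y ^+ 2 == c].
  by exists y.
rewrite negb_exists => /forallP H; exfalso.
pose Q : {poly F} := \sum_(i < m) ('X ^+ 2) ^+ (m.-1 - i) * c%:P ^+ i.
have eQ : 'X^(m.*2) - 1 = ('X ^+ 2 - c%:P) * Q.
  by rewrite -subrXX -polyC_exp cm -exprM mul2n.
have m0 := half_card_gt0.
have s0 : size ('X^(m.*2) - 1 : {poly F}) = m.*2.+1.
  by rewrite size_XnsubC // double_gt0.
have Q0 : Q != 0.
  apply/eqP => z; move: s0; rewrite eQ z mulr0 size_poly0; lia.
have sQ : (size Q <= m.*2.-1)%N.
  have p0 : 'X ^+ 2 - c%:P != 0 :> {poly F}.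
    by rewrite -size_poly_gt0 size_XnsubC.
  by move: s0; rewrite eQ size_mul // size_XnsubC // => -[<-].
have := @max_poly_roots F Q (enum [pred x : F | x != 0]) Q0.
rewrite enum_uniq -cardE cardC1 odd_card_double.
suff -> : all (root Q) (enum [pred x : F | x != 0]).
  by move=> /(_ isT isT) /= /leq_trans/(_ sQ); rewrite ltnNge leq_pred.
apply/allP => x; rewrite mem_enum inE => x0.
have : (('X ^+ 2 - c%:P) * Q).[x] = 0.
  by rewrite -eQ !hornerE expf_double_half // subrr.
rewrite hornerM => /eqP; rewrite mulf_eq0 => /orP[|//].
by rewrite !hornerE subr_eq0 (negbTE (H x)).
Qed.

Lemma nb_sqrtE (c : F) :
  nb_sqrt c = if c == 0 then 1%N else if c ^+ m == 1 then 2%N else 0%N.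
Proof.
rewrite /nb_sqrt; case: eqP => [->|/eqP c0].
  rewrite (_ : [set _ | _] = [set 0]) ?cards1 //.
  by apply/setP => y; rewrite !inE expf_eq0.
case: eqP => [/euler_criterion[y yc]|cm].
  have y0 : y != 0 by move: c0; rewrite -yc expf_eq0.
  rewrite (_ : [set _ | _] = [set y; - y]); last first.
    by apply/setP => z; rewrite !inE -yc eqf_sqr.
  rewrite cards2 -subr_eq0 opprK -mulr2n -mulr_natl mulf_eq0 (negbTE y0).
  by rewrite (negbTE two_neq0_finField).
apply/eqP; rewrite cards_eq0 -subset0; apply/subsetP => y; rewrite !inE.
move=> /eqP yc; case: cm; rewrite -yc -exprM mul2n expf_double_half //.
by move: c0; rewrite -yc expf_eq0.
Qed.

(** [c ^+ m] is the quadratic character with values in [F]; this turns point counts into power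
    sums. *)
Lemma natr_nb_sqrt (c : F) : (nb_sqrt c)%:R = 1 + c ^+ m.
Proof.
rewrite nb_sqrtE; case: eqP => [->|/eqP c0].
  by rewrite expr0n eqn0Ngt half_card_gt0 addr0.
case: eqP => [->//|/eqP]; rewrite expf_half_neq1 // => /eqP ->.
by rewrite subrr.
Qed.

Lemma nb_sqrtMsqr (c d : F) : d != 0 -> nb_sqrt (d ^+ 2 * c) = nb_sqrt c.
Proof.
move=> d0; rewrite !nb_sqrtE mulf_eq0 expf_eq0 (negbTE d0) /=.
by rewrite exprMn -exprM mul2n expf_double_half // mul1r.
Qed.

Lemma sum_nb_sqrt : (\sum_(c : F) nb_sqrt c = #|F|)%N.
Proof.
rewrite -[RHS]sum1_card [RHS](partition_big (fun y : F => y ^+ 2) xpredT) //=.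
apply: eq_bigr => c _; rewrite /nb_sqrt -sum1_card.
by apply: eq_bigl => y; rewrite inE.
Qed.

Lemma card_affine_points (a b : F) :
  #|affine_points a b| = (\sum_x nb_sqrt (x ^+ 3 + a * x + b)%R)%N.
Proof.
rewrite -[LHS]sum1_card [LHS](partition_big fst xpredT) //=.
apply: eq_bigr => x _.
rewrite /nb_sqrt -sum1_card.
rewrite (reindex_onto (fun y => (x, y)) snd) => [|[u v] /= /andP[_ /eqP->]] //.
by apply: eq_bigl => y; rewrite !inE !eqxx !andbT.
Qed.

End QuadraticResidues.

(** * Polynomials with prescribed simple roots *)

Section RootProducts.

Variable F : finFieldType.
Implicit Types (S T : {set F}) (f : {poly F}).

Definition root_prod S : {poly F} := \prod_(x in S) ('X - x%:P).

Lemma size_root_prod S : size (root_prod S) = #|S|.+1.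
Proof. by rewrite /root_prod -big_enum size_prod_XsubC cardE. Qed.

Lemma root_prod_neq0 S : root_prod S != 0.
Proof. by rewrite -size_poly_gt0 size_root_prod. Qed.

Lemma root_root_prod S x : root (root_prod S) x = (x \in S).
Proof. by rewrite /root_prod -big_enum root_prod_XsubC mem_enum. Qed.

Lemma root_prod_dvdp S f : (forall x, x \in S -> root f x) -> root_prod S %| f.
Proof.
move=> Sf; rewrite /root_prod -big_enum.
rewrite uniq_roots_dvdp ?uniq_rootsE ?enum_uniq //.
by apply/allP => x; rewrite mem_enum => /Sf.
Qed.

Lemma coprimep_root_prod S f :
  (forall x, x \in S -> ~~ root f x) -> coprimep f (root_prod S).
Proof.
move=> Sf; rewrite /root_prod; elim/big_rec: _ => [|x p xS cp].
  exact: coprimep1.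
by rewrite coprimepMr coprimep_XsubC Sf.
Qed.

End RootProducts.

(** * The Frobenius point of the twist *)

Section FrobeniusPoint.

Variables (F : finFieldType) (a b : F).
Hypotheses (F_odd : odd #|F|) (disc_neq0 : 4 * a ^+ 3 + 27 * b ^+ 2 != 0).

Local Notation q := #|F|.
Local Notation m := #|F|./2.
Local Notation lam := (cubic a b).
Local Notation mu := (lam ^+ m).

Lemma cubicE x : lam.[x] = x ^+ 3 + a * x + b.
Proof. by rewrite /cubic !hornerE. Qed.

(** Both sides equal [lam ^+ q]; the identity places [P_0 = ('X^q, mu)] on the twist. *)
Lemma cubic_frobenius :
  lam * mu ^+ 2 = ('X^q) ^+ 3 + a%:P * 'X^q + b%:P.
Proof.
rewrite -exprM muln2 -exprS -odd_card_double // /cubic !polyXD_card.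
by rewrite (exprMn _ a%:P) -!polyC_exp !expf_card exprAC.
Qed.

(** A Bezout identity writes the nonzero constant of [disc_neq0] as a combination of the cubic and
    its derivative. *)
Lemma cubic_simple_root x : root lam x -> lam^`().[x] != 0.
Proof.
move/rootP => lx; apply: contraNneq disc_neq0 => dx.
have -> : 4 * a ^+ 3 + 27 * b ^+ 2
  = (- (18 * a) * x + 27 * b) * lam.[x]
    + (6 * a * x ^+ 2 - 9 * b * x + 4 * a ^+ 2) * lam^`().[x].
  have -> : lam^`().[x] = 3 * x ^+ 2 + a.
    have -> : lam^`() = 3 *: 'X^2 + a%:P.
      by rewrite /cubic !derivE /= scaler_nat mulr1 addr0.
    by rewrite hornerD hornerZ hornerXn hornerC.
  rewrite cubicE; ring.
by rewrite lx dx !mulr0 addr0.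
Qed.

Definition res_set : {set F} := [set x | lam.[x] ^+ m == 1].
Definition nonres_set : {set F} := [set x | lam.[x] ^+ m == -1].
Definition zero_set : {set F} := [set x | lam.[x] == 0].

Local Notation U := (root_prod res_set).
Local Notation V := (root_prod nonres_set).
Local Notation W := (root_prod zero_set).

Lemma residue_classes x :
  [/\ (x \in nonres_set) = (x \notin res_set) && (x \notin zero_set)
    & (x \in zero_set) ==> (x \notin res_set)].
Proof.
rewrite !inE; have [->|l0] := eqVneq lam.[x] 0.
  rewrite expr0n eqn0Ngt half_card_gt0 //= andbF [_ == 1]eq_sym oner_eq0.
  by rewrite [0 == _]eq_sym oppr_eq0 oner_eq0.
by rewrite expf_half_neq1 // andbT.
Qed.

Lemma XqsubX_split : 'X^q - 'X = U * V * W.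
Proof.
rewrite finField_genPoly (bigID (mem res_set)) /= -mulrA; congr (_ * _).
rewrite (bigID (mem nonres_set)) /=; congr (_ * _); apply: eq_bigl => x.
  have [-> _] := residue_classes x.
  by case: (x \in res_set).
have [-> /implyP] := residue_classes x.
by case: (x \in res_set); case: (x \in zero_set) => //= /(_ isT).
Qed.

Lemma card_residue_classes : (#|res_set| + #|nonres_set| + #|zero_set| = q)%N.
Proof.
have := congr1 (fun p : {poly F} => size p) XqsubX_split.
rewrite !size_mul ?mulf_neq0 ?root_prod_neq0 // !size_root_prod.
rewrite size_polyDl ?size_polyXn ?size_polyN ?size_polyX ?ltnS //; last first.
  exact: finNzRing_gt1.
by rewrite !(addSn, addnS) /= => -[->].
Qed.

Lemma card_affine_points_residues :
  #|affine_points a b| = (#|zero_set| + #|res_set|.*2)%N.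
Proof.
rewrite card_affine_points (eq_bigr (fun x =>
  (x \in zero_set) + ((x \in res_set) + (x \in res_set)))%N); last first.
  move=> x _; rewrite nb_sqrtE // -cubicE.
  have [_ /implyP] := residue_classes x; rewrite !inE.
  by case: eqP => [_ /(_ isT)/negbTE->|_ _] //; case: eqP.
by rewrite !big_split /= -!big_mkcond !sum1_card addnn.
Qed.

(* [frob_num / ('X^q - 'X)^2] is the abscissa of [P_0 - Q], and its reduced form
   is [frob_red / frob_den], since [V^2 W] is the common factor. *)
Definition frob_num : {poly F} :=
  lam * (mu + 1) ^+ 2 - ('X^q + 'X) * ('X^q - 'X) ^+ 2.

(** The terms of degree [3q] cancel by [cubic_frobenius], which exposes the leading term of degree
    [2q + 1]. *)
Lemma frob_numE : frob_num = ('X^q) ^+ 2 * 'X + ('X^q * 'X^2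
  + a%:P * ('X^q + 'X) + 2%:P * b%:P + 2%:P * lam * mu).
Proof.
rewrite /frob_num sqrrD expr1n mulr1 !mulrDr cubic_frobenius mulr1.
rewrite -mulr_natl /cubic; ring.
Qed.

Lemma size_frob_num : size frob_num = q.*2.+2.
Proof.
have q1 := finNzRing_gt1 F; have m0 := half_card_gt0 F_odd.
have lead : size (('X^q) ^+ 2 * 'X : {poly F}) = q.*2.+2.
  by rewrite -exprM muln2 -exprSr size_polyXn.
have sX : (size ('X : {poly F}) <= q)%N by rewrite size_polyX.
have le_add (u v : {poly F}) n : (size u <= n)%N -> (size v <= n)%N ->
    (size (u + v)%R <= n)%N.
  by move=> un vn; apply: leq_trans (size_polyD _ _) _; rewrite geq_max un.
rewrite frob_numE size_polyDl lead // ltnS.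
apply: (le_add); first (apply: (le_add); first apply: (le_add)).
- rewrite -exprD size_polyXn -addnn; move: q1; lia.
- rewrite mul_polyC; apply: leq_trans (size_scale_leq _ _) _.
  apply: le_add; first by rewrite size_polyXn -addnn; move: q1; lia.
  by apply: leq_trans sX _; rewrite -addnn; lia.
- by rewrite -polyCM; apply: leq_trans (size_polyC_leq1 _) _.
- rewrite -mulrA mul_polyC; apply: leq_trans (size_scale_leq _ _) _.
  rewrite -exprS size_cubic_exp [in leqRHS]odd_card_double // -!addnn.
  by move: m0; lia.
Qed.

Lemma quad_rel_frob_num :
  quad_rel a b 'X^q 1 frob_num (('X^q - 'X) ^+ 2) = 0.
Proof.
have e := cubic_frobenius.
suff -> : quad_rel a b 'X^q 1 frob_num (('X^q - 'X) ^+ 2) =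
  4%:P * ('X^q - 'X) ^+ 2 * lam *
    (lam * mu ^+ 2 - (('X^q) ^+ 3 + a%:P * 'X^q + b%:P)).
  by rewrite e subrr mulr0.
(* What remains is an identity in [mu] and ['X^q] taken as indeterminates. *)
rewrite frob_numE /quad_rel /quad2 /quad1 /quad0; move: mu => y.
move: 'X^q => z; rewrite /cubic; ring.
Qed.

Definition frob_den : {poly F} := U ^+ 2 * W.

Definition frob_red : {poly F} :=
  (lam %/ W) * ((mu + 1) %/ V) ^+ 2 - ('X^q + 'X) * U ^+ 2 * W.

Lemma frob_divW : lam = (lam %/ W) * W.
Proof.
rewrite divpK // root_prod_dvdp // => x.
by rewrite inE rootE.
Qed.

Lemma frob_divV : mu + 1 = ((mu + 1) %/ V) * V.
Proof.
rewrite divpK // root_prod_dvdp // => x.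
by rewrite inE rootE !hornerE => /eqP ->; rewrite addNr.
Qed.

Lemma frob_redE : frob_red * (W * V ^+ 2) = frob_num.
Proof.
rewrite /frob_num XqsubX_split {1}frob_divV {1}frob_divW /frob_red; ring.
Qed.

Lemma frob_denE : frob_den * (W * V ^+ 2) = ('X^q - 'X) ^+ 2.
Proof. rewrite XqsubX_split /frob_den; ring. Qed.

(** At a root of [frob_den] the subtracted term of [frob_red] vanishes, [mu + 1] is 2 or 1, and
    [lam %/ W] is nonzero because the roots of [lam] are simple. *)
Lemma frob_coprime : coprimep frob_red frob_den.
Proof.
have two0 := two_neq0_finField F_odd.
have red_root x : x \in res_set :|: zero_set ->
    frob_red.[x] = (lam %/ W).[x] * (((mu + 1) %/ V).[x]) ^+ 2.
  rewrite inE => xs; have /eqP UW : (U ^+ 2 * W).[x] == 0.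
    by rewrite hornerM horner_exp mulf_eq0 expf_eq0 /= -!rootE !root_root_prod.
  rewrite /frob_red -[X in _ - X]mulrA hornerD hornerN.
  by rewrite [X in _ - X]hornerM UW mulr0 subr0 hornerM horner_exp.
have mu_root x : x \in res_set :|: zero_set -> ((mu + 1) %/ V).[x] != 0.
  move=> xs; have : (mu + 1).[x] != 0.
    rewrite hornerD hornerC horner_exp; move: xs.
    rewrite !inE => /orP[/eqP->//|/eqP->].
    by rewrite expr0n eqn0Ngt half_card_gt0 // add0r oner_neq0.
  by rewrite {1}frob_divV hornerM mulf_eq0 negb_or => /andP[].
have lam_root x : x \in res_set :|: zero_set -> (lam %/ W).[x] != 0.
  move=> xs; have [lx|lx] := boolP (root lam x); last first.
    by move: lx; rewrite rootE {1}frob_divW hornerM mulf_eq0 negb_or => /andP[].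
  have := cubic_simple_root lx; rewrite {1}frob_divW derivM hornerD !hornerM.
  have /rootP -> : root W x by rewrite root_root_prod inE -rootE.
  by rewrite mulr0 add0r mulf_eq0 negb_or => /andP[].
have nr x : x \in res_set :|: zero_set -> ~~ root frob_red x.
  move=> xs; rewrite rootE red_root // mulf_neq0 ?expf_neq0 //.
    exact: lam_root.
  exact: mu_root.
rewrite coprimepMr coprimep_expr ?coprimep_root_prod //= => x xs.
  by rewrite nr // inE xs orbT.
by rewrite nr // inE xs.
Qed.

Lemma size_frob_den : size frob_den = (#|res_set|.*2 + #|zero_set|).+1.
Proof.
rewrite /frob_den expr2 !size_mul ?mulf_neq0 ?root_prod_neq0 //.
by rewrite !size_root_prod -addnn !addSn !addnS.
Qed.

(** Removing [W * V ^+ 2] lowers the degree from [2q + 1] to [#|zero_set| + 2 #|res_set| + 1], which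
    is [N + 1]. *)
Lemma size_frob_red : size frob_red = (#|affine_points a b|).+2.
Proof.
have := size_frob_num; rewrite -frob_redE.
have r0 : frob_red != 0.
  apply/eqP => z; have := size_frob_num.
  by rewrite -frob_redE z mul0r size_poly0.
rewrite expr2 !size_mul ?mulf_neq0 ?root_prod_neq0 // !size_root_prod.
rewrite card_affine_points_residues -card_residue_classes.
move: (size _) #|_| #|_| #|_| => u v w z; lia.
Qed.

Lemma frobenius_adjacent :
  adjacent a b frob_red frob_den 'X^q 1.
Proof.
apply: adjacentC; split.
- exact: coprimep1.
- exact: frob_coprime.
- by rewrite size_poly1 size_polyXn ltnS ltnW ?finNzRing_gt1.
- by rewrite size_frob_red size_frob_den card_affine_points_residues addnC.
(* [quad_rel] is homogeneous of degree two in each pair, so the common factor comes out squared. *)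
have k0 : (W * V ^+ 2) ^+ 2 != 0.
  by rewrite !(expf_neq0, mulf_neq0) ?root_prod_neq0.
apply: (mulfI k0); rewrite mulr0 -[RHS]quad_rel_frob_num.
rewrite -frob_redE -frob_denE /quad_rel; ring.
Qed.

Lemma hasse_quadratic (n : int) :
  0 <= n ^+ 2 + (#|affine_points a b|%:Z - q%:Z) * n + q%:Z.
Proof.
have two0 := two_neq0_finField F_odd.
have adj := frobenius_adjacent.
have s1 := size_frob_red; have s2 : size ('X^q : {poly F}) = q.+1.
  exact: size_polyXn.
(* Steps from [P_0] to [P_0 - Q] and onwards cover [n >= 0]. The opposite walk starts at [P_0 - Q],
   so its term of index [n.+2] belongs to [P_0 + (n + 1) Q]. *)
case: n => n.
  have := adjacent_degree_gt0 two0 disc_neq0 (adjacentC adj) n.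
  by rewrite s1 s2; move: #|_| #|_| => u v; lia.
have := adjacent_degree_gt0 two0 disc_neq0 adj n.+2.
by rewrite s1 s2 NegzE; move: #|_| #|_| => u v; lia.
Qed.

Lemma hasse_nonsingular : (q%:Z - #|affine_points a b|%:Z) ^+ 2 <= 4 * q%:Z.
Proof.
have half (k : int) : exists j : int, k = 2 * j \/ k = 2 * j + 1.
  by exists (k %/ 2)%Z; lia.
have q_odd := odd_card_double F_odd.
(* The quadratic is evaluated at an integer nearest to its minimum [(q - N) / 2]. *)
have [k hk] := half (q%:Z - #|affine_points a b|%:Z).
have := hasse_quadratic k.
have -> : #|affine_points a b|%:Z - q%:Z = - (q%:Z - #|affine_points a b|%:Z).
  by rewrite opprB.
move: q_odd hk; move: m (q%:Z - _) => h t; move: #|_| => u ->.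
case=> ->; first lia.
(* [k (k + 1)] is even while [q] is odd, so [k (k + 1) <= q] is strict *)
have [j [->|->]] := half k; lia.
Qed.

End FrobeniusPoint.

(** * Singular cubics and Hasse's bound *)

Section SingularCubic.

Variables (F : finFieldType) (a b : F).
Hypotheses (F_odd : odd #|F|) (three_neq0 : (3 : F) != 0).

Lemma singular_cubic_double_root : 4 * a ^+ 3 + 27 * b ^+ 2 = 0 ->
  exists c : F, a = - 3 * c ^+ 2 /\ b = 2 * c ^+ 3.
Proof.
have two0 := two_neq0_finField F_odd.
move=> e; have [a0|a0] := eqVneq a 0.
  exists 0; rewrite !expr0n !mulr0; split=> //; apply/eqP.
  move: e; rewrite a0 expr0n mulr0 add0r => /eqP.
  have -> : (27 : F) = 3 ^+ 3 by ring.
  by rewrite mulf_eq0 !expf_eq0 /= (negbTE three_neq0).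
(* A common root of the cubic and its derivative is a root of [3 (x^3 + a x + b) - x (3 x^2 + a) = 2
   a x + 3 b]. *)
exists (- 3 * b / (2 * a)).
have four0 : (4 : F) != 0.
  by rewrite (_ : 4 = 2 * 2 :> F) ?mulf_neq0 //; ring.
split; apply/eqP; rewrite -subr_eq0; apply/eqP.
  transitivity ((4 * a ^+ 3 + 27 * b ^+ 2) / (4 * a ^+ 2)).
    by field; rewrite ?a0 ?four0 ?two0.
  by rewrite e mul0r.
transitivity (b * (4 * a ^+ 3 + 27 * b ^+ 2) / (4 * a ^+ 3)).
  by field; rewrite ?a0 ?four0 ?two0.
by rewrite e mulr0 mul0r.
Qed.

(** Away from [c], the value [(x - c)^2 (x + 2 c)] has as many square roots as [x + 2 c]. These
    numbers sum to [q] over all [x], so only the term at [c] needs correcting. *)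
Lemma hasse_singular : 4 * a ^+ 3 + 27 * b ^+ 2 = 0 ->
  (#|F|%:Z - #|affine_points a b|%:Z) ^+ 2 <= 4 * #|F|%:Z.
Proof.
move=> /singular_cubic_double_root[c [ea eb]].
have N : (#|affine_points a b| + nb_sqrt (3 * c)%R = #|F|.+1)%N.
  rewrite card_affine_points (bigD1 c) //=.
  have -> : c ^+ 3 + a * c + b = 0 by rewrite ea eb; ring.
  rewrite nb_sqrtE // eqxx add1n addSn; congr _.+1.
  rewrite -[RHS]sum_nb_sqrt [RHS](reindex_inj (addIr (2 * c))).
  rewrite [RHS](bigD1 c) //=.
  have -> : c + 2 * c = 3 * c by ring.
  rewrite addnC; congr (_ + _)%N; apply: eq_bigr => x xc.
  rewrite -(@nb_sqrtMsqr F F_odd (x + 2 * c) (x - c)) ?subr_eq0 //.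
  by congr nb_sqrt; rewrite ea eb; ring.
have s2 : (nb_sqrt (3 * c)%R <= 2)%N.
  by rewrite nb_sqrtE //; case: ifP => // _; case: ifP.
have F1 := finNzRing_gt1 F.
have : #|F|%:Z - #|affine_points a b|%:Z \in [:: -1; 0; 1].
  move: N s2 F1; move: (nb_sqrt _) #|_| #|_| => u v w.
  rewrite !inE; lia.
rewrite !inE => /or3P[] /eqP ->; move: F1; lia.
Qed.

End SingularCubic.

Theorem hasse_bound (F : finFieldType) (a b : F) :
  odd #|F| -> (3 : F) != 0 ->
  (#|F|%:Z - #|affine_points a b|%:Z) ^+ 2 <= 4 * #|F|%:Z.
Proof.
move=> F_odd three0; have [d0|d0] := eqVneq (4 * a ^+ 3 + 27 * b ^+ 2) 0.
  exact: hasse_singular.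
exact: hasse_nonsingular.
Qed.

(** The power [cubic ^+ m] has degree [3m < 2 (q - 1)], so summing it over [F] leaves only the
    coefficient at [q - 1], negated. *)
Lemma natr_card_affine_points (F : finFieldType) (a b : F) : odd #|F| ->
  #|affine_points a b|%:R = - (cubic a b ^+ (#|F|./2))`_(#|F|.-1) :> F.
Proof.
move=> F_odd; rewrite card_affine_points natr_sum.
rewrite (eq_bigr (fun x => 1 + (cubic a b ^+ #|F|./2).[x])); last first.
  by move=> x _; rewrite natr_nb_sqrt // horner_exp cubicE.
rewrite big_split /= sumr_const finField_natr_card add0r.
have m0 := half_card_gt0 F_odd.
have sP : (size (cubic a b ^+ #|F|./2) <= #|F|.-1.*2)%N.
  rewrite size_cubic_exp [in leqRHS](odd_card_double F_odd) -!addnn /=.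
  by move: m0; lia.
under eq_bigr do rewrite (horner_coef_wide _ sP).
rewrite exchange_big /=.
have kP : (#|F|.-1 < #|F|.-1.*2)%N.
  rewrite (odd_card_double F_odd) /= -!addnn; move: m0; lia.
rewrite (bigD1 (Ordinal kP)) //= -mulr_sumr sum_expf // eqxx mulrN1.
rewrite big1 ?addr0 // => i; rewrite -val_eqE /= => ik.
by rewrite -mulr_sumr sum_expf // (negbTE ik) mulr0.
Qed.

(** * Kronecker substitution *)

Lemma digit_of_sum (c : nat -> nat) M n k :
  (forall i, c i < M)%N -> (k < n)%N ->
  ((\sum_(i < n) c i * M ^ i) %/ M ^ k %% M = c k)%N.
Proof.
move=> cM; have M0 : (0 < M)%N by apply: leq_ltn_trans (cM 0%N).
elim: k n c cM => [|k IHk] [//|n] c cM kn; rewrite big_ord_recl /= muln1.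
  under eq_bigr do rewrite /bump add1n expnSr mulnA.
  by rewrite divn1 -big_distrl /= addnC modnMDl modn_small.
under eq_bigr do rewrite /bump add1n expnSr mulnA.
rewrite -big_distrl /= expnS divnMA addnC divnMDl // (divn_small (cM _)) addn0.
exact: (IHk n (fun i => c i.+1)).
Qed.

(** [P.[1]] is the sum of the coefficients and bounds each of them, so they are the base-[M] digits
    of [P.[M]]. *)
Lemma coef_kronecker (P : {poly nat}) (M k : nat) : (P.[1] < M)%N ->
  (P.[M] %/ M ^ k %% M)%N = P`_k.
Proof.
move=> PM; have cM i : ((P`_i)%R < M)%N.
  apply: leq_ltn_trans PM; have [le|lt] := leqP (size P) i.
    by rewrite nth_default.
  rewrite horner_coef (bigD1 (Ordinal lt)) //= expr1n mulr1.
  exact: leq_addr.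
have n0 : (k < maxn (size P) k.+1)%N by rewrite leq_maxr.
rewrite (@horner_coef_wide _ (maxn (size P) k.+1)) ?leq_maxl //.
exact: (digit_of_sum (c := fun i => (P`_i)%R)).
Qed.

(** * Projective points *)

Section ProjectivePoints.

Variables (F : finFieldType) (a b : F).

Lemma proj_pointZ (c : F) (v : 'rV[F]_3) : c != 0 ->
  proj_point (c *: v) = proj_point v.
Proof.
move=> c0; apply/setP => w; apply/imsetP/imsetP => -[d]; rewrite inE => d0 ->.
  by exists (d * c); rewrite ?inE ?mulf_neq0 ?scalerA.
exists (d / c); first by rewrite inE mulf_neq0 ?invr_neq0.
by rewrite scalerA divfK.
Qed.

Lemma mem_proj_point (v : 'rV[F]_3) : v \in proj_point v.
Proof. by apply/imsetP; exists 1; rewrite ?inE ?oner_neq0 ?scale1r. Qed.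

Definition row3 (x y z : F) : 'rV[F]_3 :=
  \row_(i < 3) (if i == 0 then x else if i == 1 then y else z).

Lemma row3_eta (v : 'rV[F]_3) : v = row3 (v 0 0) (v 0 1) (v 0 2).
Proof.
apply/rowP => i; rewrite mxE.
by case: i => -[|[|[|]]] //= ilt; congr (v 0 _); apply: val_inj.
Qed.

Lemma scale_row3 c x y z : c *: row3 x y z = row3 (c * x) (c * y) (c * z).
Proof. by apply/rowP => i; rewrite !mxE; do 2?case: ifP. Qed.

Lemma row3_inj x y z x' y' z' : row3 x y z = row3 x' y' z' ->
  [/\ x = x', y = y' & z = z'].
Proof.
by move/rowP=> e; split; [have := e 0|have := e 1|have := e 2]; rewrite !mxE.
Qed.

(** [None] stands for the point at infinity [[0 : 1 : 0]]. *)
Definition projective_of_affine (o : option (F * F)) : {set 'rV[F]_3} :=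
  if o is Some P then proj_point (row3 P.1 P.2 1) else proj_point (row3 0 1 0).

Lemma projective_of_affine_inj : injective projective_of_affine.
Proof.
have h (v w : 'rV[F]_3) : proj_point v = proj_point w ->
    exists2 c, c != 0 & v = c *: w.
  move=> e; have := mem_proj_point v; rewrite e => /imsetP[c].
  by rewrite inE => c0 ->; exists c.
move=> [[x y]|] [[x' y']|] //= /h[c c0]; rewrite scale_row3.
- by case/row3_inj=> -> -> /esym; rewrite mulr1 => ->; rewrite !mul1r.
- by case/row3_inj=> _ _ /eqP; rewrite mulr0 oner_eq0.
- by case/row3_inj=> _ _ /eqP; rewrite mulr1 eq_sym (negbTE c0).
Qed.

Lemma card_projective_points :
  #|projective_points a b| = (#|affine_points a b| + 1)%N.
Proof.
pose A : {set option (F * F)} := None |: [set Some P | P in affine_points a b].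
have -> : projective_points a b = projective_of_affine @: A.
  apply/setP => S; apply/imsetP/imsetP => [[v]|[o oA ->]].
    rewrite inE => /andP[v0 ev] ->; move: v0 ev; rewrite {1 3}(row3_eta v).
    rewrite /homogeneous_eqn.
    set x := v 0 0; set y := v 0 1; set z := v 0 2 => v0 /eqP e.
    (* On the line [z = 0] the equation reduces to [x^3 = 0]; elsewhere [z] is scaled to 1. *)
    have [z0|z0] := eqVneq z 0.
      have x0 : x = 0.
        move: e; rewrite z0 !expr0n /= !mulr0 !addr0 => /esym/eqP.
        by rewrite expf_eq0 => /eqP.
      have y0 : y != 0.
        apply: contraNneq v0 => y0; rewrite x0 y0 z0; apply/eqP/rowP => i.
        by rewrite !mxE; do 2?case: ifP.
      exists None; first by rewrite setU11.
      rewrite /= -(proj_pointZ (row3 0 1 0) y0) scale_row3 mulr1 mulr0.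
      by rewrite x0 z0.
    exists (Some (x / z, y / z)).
      rewrite setU1r //; apply: imset_f; rewrite inE /=; apply/eqP.
      apply: (mulIf (expf_neq0 3 z0)).
      transitivity (y ^+ 2 * z); first by field.
      by rewrite e; field.
    rewrite /= -[RHS](proj_pointZ _ z0) scale_row3 mulr1.
    by rewrite mulrCA divff // mulrCA divff // !mulr1.
  case/setU1P: oA => [->|/imsetP[[x y] /[!inE] /= /eqP e ->]].
    exists (row3 0 1 0) => //; rewrite inE /homogeneous_eqn !mxE /=.
    rewrite !expr0n /= !mulr0 !addr0 eqxx andbT.
    by apply/eqP => /rowP/(_ 1)/eqP; rewrite !mxE oner_eq0.
  exists (row3 x y 1) => //; rewrite inE /homogeneous_eqn !mxE /=.
  rewrite !expr1n !mulr1 e eqxx andbT.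
  by apply/eqP => /rowP/(_ 2)/eqP; rewrite !mxE oner_eq0.
rewrite (card_imset _ projective_of_affine_inj) /A cardsU1.
rewrite (card_imset (mem (affine_points a b)) (@Some_inj _)) addnC.
by congr (_ + _)%N; case: imsetP => // -[P _].
Qed.

End ProjectivePoints.

(** * Recovering the point count from its residue *)

Lemma kronecker_base_gt (p A B m : nat) : (1 < p)%N -> (A < p)%N -> (B < p)%N ->
  (m <= p)%N -> ((1 + A + B) ^ m < 2 ^ (p ^ 2))%N.
Proof.
move=> p1 Ap Bp mp.
(* [1 + A + B < 2p <= 2^p]. *)
have base : (1 + A + B < 2 ^ p)%N.
  have h n : (1 < n -> n.*2 <= 2 ^ n)%N.
    case: n => [//|[//|n]] _; elim: n => [//|n IHn].
    rewrite expnS mul2n leq_double; apply: leq_trans IHn.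
    by rewrite -addnn; lia.
  by apply: leq_trans (h p p1); rewrite -addnn; lia.
have [->|m0] := posnP m.
  by rewrite expn0 -[1%N](expn0 2) ltn_exp2l // expn_gt0 ltnW.
apply: (@leq_trans ((2 ^ p) ^ m)); first by rewrite ltn_exp2r.
by rewrite -expnM leq_exp2l // -mulnn leq_mul2l mp orbT.
Qed.

(** The digit is extracted over the natural numbers, where no carries occur, and only then reduced
    modulo [p]. *)
Lemma coef_cubic_exp_kronecker (p : nat) (A B : nat) : (2 < p)%N -> prime p ->
  (A < p)%N -> (B < p)%N ->
  (((((2 ^ (3 * p ^ 2) + A * 2 ^ (p ^ 2) + B) ^ (p %/ 2))
      %/ (2 ^ (p ^ 2 * (p - 1)))) %% (2 ^ (p ^ 2)))%N)%:R
  = (cubic (A%:R : 'F_p) B%:R ^+ (p %/ 2))`_(p - 1).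
Proof.
move=> p2 p_pr Ap Bp.
pose P : {poly nat} := ('X^3 + A%:P * 'X + B%:P) ^+ (p %/ 2).
have PE (x : nat) : P.[x] = ((x ^ 3 + A * x + B) ^ (p %/ 2))%N.
  by rewrite horner_exp !hornerD hornerXn hornerM !hornerC hornerX.
have P1 : (P.[1%N] < 2 ^ (p ^ 2))%N.
  by rewrite PE exp1n muln1 kronecker_base_gt ?leq_div // ltnW.
have := coef_kronecker (p - 1) P1.
rewrite PE -!expnM [(p ^ 2 * 3)%N]mulnC => ->.
rewrite -(coef_map (GRing.natmul (1 : 'F_p))) /P rmorphXn !rmorphD rmorphM /=.
by rewrite map_polyXn map_polyX !map_polyC.
Qed.

(** The truncated factor [1 - ((4 * p + 1) - r ^ 2)] is the indicator of [r ^ 2 > 4 * p]. *)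
Lemma trace_of_residue (p r N : nat) : (17 <= p)%N -> (r < p)%N ->
  (p %| r + N)%N -> (p%:Z - N%:Z) ^+ 2 <= 4 * p%:Z ->
  N = ((p - r) + p * (1 - ((4 * p + 1) - r ^ 2)))%N /\
  p%:Z - N%:Z = (if (r ^ 2 <= 4 * p)%N then r%:Z else r%:Z - p%:Z).
Proof.
move=> p17 rp /dvdnP[j ej] hasse.
(* Otherwise [p^2 <= 4 a^2 <= 16 p], against [p >= 17]. *)
have small (a : int) : a ^+ 2 <= 4 * p%:Z -> 2 * a < p%:Z.
  move=> ha; rewrite ltNge; apply/negP => pa.
  have : p%:Z * p%:Z <= (2 * a) * (2 * a) by apply: ler_pM.
  have : 17 * p%:Z <= p%:Z * p%:Z by apply: ler_wpM2r.
  lia.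
have a_lt := small _ hasse.
have a_gt : 2 * - (p%:Z - N%:Z) < p%:Z by apply: small; rewrite sqrrN.
have ea : p%:Z - N%:Z = r%:Z + (1 - j%:Z) * p%:Z.
  have : r%:Z + N%:Z = j%:Z * p%:Z by rewrite -PoszD -PoszM ej.
  lia.
(* As [p - N = r + (1 - j) p] with [0 <= r < p] and [2 |p - N| < p], no other [j] fits. *)
have jE : j = 1%N \/ j = 2.
  case: j ea {ej} => [|[|[|j]]]; [lia|by left|by right|] => ea.
  have : 0 <= j%:Z * p%:Z by apply: mulr_ge0.
  lia.
have [rr|rr] := leqP (r ^ 2) (4 * p).
  have r_lt : 2 * r%:Z < p%:Z by apply: small; lia.
  have {}ea : p%:Z - N%:Z = r%:Z by case: jE ea => ->; lia.
  split=> //; have -> : (1 - (4 * p + 1 - r ^ 2) = 0)%N by lia.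
  lia.
have {}ea : p%:Z - N%:Z = r%:Z - p%:Z.
  case: jE ea => -> ea; last lia.
  have e : p%:Z - N%:Z = r%:Z by lia.
  move: hasse; rewrite e; lia.
split=> //; have -> : (1 - (4 * p + 1 - r ^ 2) = 1)%N by lia.
lia.
Qed.

Theorem theorem6 (p : nat) (p_prime : prime p) (p_ge17 : (17 <= p)%N)
    (A B : nat) :
  let Abar := (A %% p)%N in
  let Bbar := (B %% p)%N in
  let r := (((((2 ^ (3 * p ^ 2) + Abar * 2 ^ (p ^ 2) + Bbar) ^ (p %/ 2))
               %/ (2 ^ (p ^ 2 * (p - 1)))) %% (2 ^ (p ^ 2))) %% p)%N in
  let N := #|affine_points (A%:R : 'F_p) (B%:R : 'F_p)| in
  let a_p : int := p%:Z - N%:Z in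
  [/\ N = ((p - r) + p * (1 - ((4 * p + 1) - r ^ 2)))%N,
      a_p = (if (r ^ 2 <= 4 * p)%N then r%:Z else r%:Z - p%:Z),
      (4 * Abar ^ 3 + 27 * Bbar ^ 2 != 0 %[mod p])%N ->
        exists E : elliptic_curve 'F_p,
          [/\ ec_a E = Abar%:R, ec_b E = Bbar%:R & a_p = frobenius_trace E]
    & #|projective_points (Abar%:R : 'F_p) (Bbar%:R : 'F_p)| = (N + 1)%N].
Proof.
have p0 := prime_gt0 p_prime.
have p_odd : odd p by case: (even_prime p_prime) => // p2; rewrite p2 in p_ge17.
have Fp_eq0 (n : nat) : ((n%:R : 'F_p) == 0) = (p %| n)%N.
  by rewrite -(dvdn_pcharf (pchar_Fp p_prime)).
have small_neq0 (n : nat) : (0 < n < 17)%N -> (n%:R : 'F_p) != 0.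
  case/andP=> n0 n17; rewrite Fp_eq0; apply/negP => /dvdn_leq.
  by move=> /(_ n0); rewrite leqNgt (leq_trans n17).
move=> Abar Bbar r N a_p.
have eA : Abar%:R = A%:R :> 'F_p by rewrite /Abar Fp_nat_mod.
have eB : Bbar%:R = B%:R :> 'F_p by rewrite /Bbar Fp_nat_mod.
have F_card := card_Fp p_prime.
have r_coef : (r%:R : 'F_p) = (cubic (A%:R : 'F_p) B%:R ^+ (p %/ 2))`_(p - 1).
  rewrite /r Fp_nat_mod // coef_cubic_exp_kronecker ?ltn_pmod // ?eA ?eB //.
  exact: leq_trans p_ge17.
(* Modulo [p], [r] is the coefficient at [p - 1] and [N] is its negative. *)
have rN : ((r + N)%N%:R : 'F_p) == 0.
  rewrite natrD r_coef natr_card_affine_points ?F_card //.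
  by rewrite divn2 subn1 subrr.
have hasse : (p%:Z - N%:Z) ^+ 2 <= 4 * p%:Z.
  have := @hasse_bound 'F_p A%:R B%:R; rewrite F_card; apply=> //.
  exact: (small_neq0 3).
have [N_eq a_p_eq] : N = ((p - r) + p * (1 - ((4 * p + 1) - r ^ 2)))%N /\
    a_p = (if (r ^ 2 <= 4 * p)%N then r%:Z else r%:Z - p%:Z).
  by apply: trace_of_residue => //; rewrite ?ltn_pmod // -Fp_eq0.
split=> //.
- move=> disc.
  have d0 : - 16 * (4 * (Abar%:R : 'F_p) ^+ 3 + 27 * Bbar%:R ^+ 2) != 0.
    rewrite mulf_neq0 ?oppr_eq0 ?(small_neq0 16) //.
    rewrite -!natrX -!natrM -natrD Fp_eq0.
    by move: disc; rewrite mod0n.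
  exists (EllipticCurve d0); split=> //.
  rewrite /frobenius_trace /= card_projective_points F_card eA eB -/N /a_p.
  by rewrite PoszD opprD addrACA subrr addr0.
- by rewrite card_projective_points eA eB.
Qed.
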